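(* Identify $\blacktriangle,\blacktriangledown,\vartriangle,\triangledown$ with $F,G,P,H$, respectively. Then Int2GC can be axiomatised by adding to the axioms of intuitionistic logic the schemes $G(A\to B)\to(GA\to GB)$, $H(A\to B)\to(HA\to HB)$, $FHA\to A$, $PGA\to A$, $A\to HFA$, $A\to GPA$, together with the rules modus ponens, (RH) from $A$ infer $HA$, (RG) from $A$ infer $GA$, (RMF) from $A\to B$ infer $FA\to FB$, and (RMP) from $A\to B$ infer $PA\to PB$. That is, this system proves exactly the same formulas as Int2GC.
   Context: Formulas are built from a countably infinite set of propositional variables with the connectives $\neg,\vee,\wedge,\to$ and four unary connectives $\blacktriangle,\blacktriangledown,\vartriangle,\triangledown$ (written $F,G,P,H$ under the identification). The logic Int2GC is the smallest set of formulas (called provable formulas) that contains intuitionistic propositional logic (in this language) and is closed under substitution, modus ponens, and the four rules: from $A\to\triangledown B$ infer $\blacktriangle A\to B$; from $\blacktriangle A\to B$ infer $A\to\triangledown B$; from $A\to\blacktriangledown B$ infer $\vartriangle A\to B$; from $\vartriangle A\to B$ infer $A\to\blacktriangledown B$. *)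

(* Defs.v *)
Inductive form : Type :=
| Var (n : nat)
| Neg (A : form)
| Or (A B : form)
| And (A B : form)
| Imp (A B : form)
| F (A : form)   (* black up triangle *)
| G (A : form)   (* black down triangle *)
| P (A : form)   (* white up triangle *)
| H (A : form).  (* white down triangle *)

Declare Scope form_scope.
Delimit Scope form_scope with form.
Bind Scope form_scope with form.
Notation "¬ A" := (Neg A) (at level 35, right associativity) : form_scope.
Infix "⩓" := And (at level 40, left associativity) : form_scope.
Infix "⩔" := Or (at level 50, left associativity) : form_scope.
Infix "⇒" := Imp (at level 60, right associativity) : form_scope.
Local Open Scope form_scope.

Fixpoint subst (s : nat -> form) (A : form) : form :=
  match A with
  | Var n => s n
  | ¬ A => ¬ subst s A
  | A ⩔ B => subst s A ⩔ subst s B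
  | A ⩓ B => subst s A ⩓ subst s B
  | A ⇒ B => subst s A ⇒ subst s B
  | F A => F (subst s A)
  | G A => G (subst s A)
  | P A => P (subst s A)
  | H A => H (subst s A)
  end.

(** Standard Hilbert axiom schemes of intuitionistic propositional logic;
    the metavariables range over the whole language, modal formulas included. *)
Inductive int_axiom : form -> Prop :=
| ax_K A B : int_axiom (A ⇒ B ⇒ A)
| ax_S A B C : int_axiom ((A ⇒ B ⇒ C) ⇒ (A ⇒ B) ⇒ A ⇒ C)
| ax_and_l A B : int_axiom (A ⩓ B ⇒ A)
| ax_and_r A B : int_axiom (A ⩓ B ⇒ B)
| ax_and_i A B : int_axiom (A ⇒ B ⇒ A ⩓ B)
| ax_or_l A B : int_axiom (A ⇒ A ⩔ B)
| ax_or_r A B : int_axiom (B ⇒ A ⩔ B)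
| ax_or_e A B C : int_axiom ((A ⇒ C) ⇒ (B ⇒ C) ⇒ A ⩔ B ⇒ C)
| ax_neg_i A B : int_axiom ((A ⇒ B) ⇒ (A ⇒ ¬ B) ⇒ ¬ A)
| ax_neg_e A B : int_axiom (¬ A ⇒ A ⇒ B).

Inductive IPL : form -> Prop :=
| IPL_ax A : int_axiom A -> IPL A
| IPL_mp A B : IPL (A ⇒ B) -> IPL A -> IPL B.

Inductive Int2GC : form -> Prop :=
| Int2GC_IPL A : IPL A -> Int2GC A
| Int2GC_subst s A : Int2GC A -> Int2GC (subst s A)
| Int2GC_mp A B : Int2GC (A ⇒ B) -> Int2GC A -> Int2GC B
| Int2GC_FH A B : Int2GC (A ⇒ H B) -> Int2GC (F A ⇒ B)
| Int2GC_HF A B : Int2GC (F A ⇒ B) -> Int2GC (A ⇒ H B)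
| Int2GC_PG A B : Int2GC (A ⇒ G B) -> Int2GC (P A ⇒ B)
| Int2GC_GP A B : Int2GC (P A ⇒ B) -> Int2GC (A ⇒ G B).

(** The axioms are schemes, so there is no substitution rule. *)
Inductive Tense : form -> Prop :=
| Tense_int A : int_axiom A -> Tense A
| Tense_KG A B : Tense (G (A ⇒ B) ⇒ G A ⇒ G B)
| Tense_KH A B : Tense (H (A ⇒ B) ⇒ H A ⇒ H B)
| Tense_FH A : Tense (F (H A) ⇒ A)
| Tense_PG A : Tense (P (G A) ⇒ A)
| Tense_HF A : Tense (A ⇒ H (F A))
| Tense_GP A : Tense (A ⇒ G (P A))
| Tense_mp A B : Tense (A ⇒ B) -> Tense A -> Tense B
| Tense_RH A : Tense A -> Tense (H A)
| Tense_RG A : Tense A -> Tense (G A)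
| Tense_RMF A B : Tense (A ⇒ B) -> Tense (F A ⇒ F B)
| Tense_RMP A B : Tense (A ⇒ B) -> Tense (P A ⇒ P B).

(* Main.v *)
(** In any logic containing intuitionistic logic, the two rules making [f] left
    adjoint to [g] are equivalent to monotonicity of [f] and [g] together with the
    unit and counit laws.  Monotonicity of [g] follows from K and necessitation;
    conversely, K is the transpose of the theorem
    [f (g (A ⇒ B) ⩓ g A) ⇒ B], obtained by transposing the two projections. *)
Require Import Defs.
Local Open Scope form_scope.

(** The common ground of both systems, so that each fact about adjoint pairs is proved once and then
    used in [Tense] or in [Int2GC]. *)
Definition int_theory (L : form -> Prop) : Prop :=
  (forall A, int_axiom A -> L A) /\ (forall A B, L (A ⇒ B) -> L A -> L B).

Lemma int_theory_weaken L A B : int_theory L -> L B -> L (A ⇒ B).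
Proof. intros [ax mp] HB. exact (mp _ _ (ax _ (ax_K B A)) HB). Qed.

Lemma int_theory_mp_under L A B C :
  int_theory L -> L (A ⇒ B ⇒ C) -> L (A ⇒ B) -> L (A ⇒ C).
Proof.
  intros [ax mp] HBC HB.
  exact (mp _ _ (mp _ _ (ax _ (ax_S A B C)) HBC) HB).
Qed.

Lemma int_theory_trans L A B C :
  int_theory L -> L (A ⇒ B) -> L (B ⇒ C) -> L (A ⇒ C).
Proof.
  intros T HAB HBC.
  exact (int_theory_mp_under L A B C T (int_theory_weaken L _ _ T HBC) HAB).
Qed.

Lemma int_theory_curry L A B C :
  int_theory L -> L (A ⩓ B ⇒ C) -> L (A ⇒ B ⇒ C).
Proof.
  intros T HC. pose proof T as [ax mp].
  apply (int_theory_trans L _ (B ⇒ A ⩓ B)); [exact T | apply ax, ax_and_i |].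
  (* S applied to the weakened premise gives postcomposition with [A ⩓ B ⇒ C] under [B]. *)
  apply (mp _ _ (ax _ (ax_S B (A ⩓ B) C))), int_theory_weaken; assumption.
Qed.

(** A Galois connection on formulas preordered by [L]-provable implication. *)
Definition adjoint_in (L : form -> Prop) (f g : form -> form) : Prop :=
  (forall A B, L (A ⇒ g B) -> L (f A ⇒ B)) /\
  (forall A B, L (f A ⇒ B) -> L (A ⇒ g B)).

Lemma adjoint_counit L f g A :
  int_theory L -> adjoint_in L f g -> L (f (g A) ⇒ A).
Proof.
  intros T [left _]. pose proof T as [ax mp]. apply left.
  (* The identity [g A ⇒ g A], derived as the combinator SKK. *)
  exact (int_theory_mp_under L _ (g A ⇒ g A) _ T
           (ax _ (ax_K _ _)) (ax _ (ax_K _ _))).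
Qed.

Lemma adjoint_unit L f g A :
  int_theory L -> adjoint_in L f g -> L (A ⇒ g (f A)).
Proof.
  intros T [_ right]. pose proof T as [ax mp]. apply right.
  exact (int_theory_mp_under L _ (f A ⇒ f A) _ T
           (ax _ (ax_K _ _)) (ax _ (ax_K _ _))).
Qed.

Lemma adjoint_left_mono L f g A B :
  int_theory L -> adjoint_in L f g -> L (A ⇒ B) -> L (f A ⇒ f B).
Proof.
  intros T adj HAB. pose proof (proj1 adj) as left. apply left.
  apply (int_theory_trans L _ B); [assumption .. |].
  now apply adjoint_unit.
Qed.

Lemma adjoint_right_nec L f g A :
  int_theory L -> adjoint_in L f g -> L A -> L (g A).
Proof.
  intros T [_ right] HA. pose proof (proj2 T) as mp.
  (* The theorem [A] itself serves as premise: [f A ⇒ A] holds by weakening and transposes to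
     [A ⇒ g A]. *)
  apply (mp A); [| exact HA].
  now apply right, int_theory_weaken.
Qed.

Lemma adjoint_right_K L f g A B :
  int_theory L -> adjoint_in L f g -> L (g (A ⇒ B) ⇒ g A ⇒ g B).
Proof.
  intros T adj. pose proof (proj1 T) as ax.
  apply int_theory_curry; [exact T |]. apply (proj2 adj).
  apply (int_theory_mp_under L _ A); [exact T | |]; apply (proj1 adj).
  - apply ax, ax_and_l.
  - apply ax, ax_and_r.
Qed.

(** The transposes are the composites [f A ⇒ f (g B) ⇒ B] and [A ⇒ g (f A) ⇒ g B], read as
    chains. *)
Lemma adjoint_of_unit_counit L f g :
  int_theory L ->
  (forall A B, L (A ⇒ B) -> L (f A ⇒ f B)) ->
  (forall A B, L (g (A ⇒ B) ⇒ g A ⇒ g B)) ->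
  (forall A, L A -> L (g A)) ->
  (forall A, L (A ⇒ g (f A))) ->
  (forall A, L (f (g A) ⇒ A)) ->
  adjoint_in L f g.
Proof.
  intros T mono K nec unit counit. pose proof (proj2 T) as mp.
  split; intros A B HAB.
  - apply (int_theory_trans L _ (f (g B))); auto.
  - apply (int_theory_trans L _ (g (f A))); [exact T | apply unit |].
    exact (mp _ _ (K _ _) (nec _ HAB)).
Qed.

Lemma int_axiom_subst s A : int_axiom A -> int_axiom (subst s A).
Proof. destruct 1; constructor. Qed.

(** Substitution is admissible because axioms and rules are schematic: applying [s] throughout a
    derivation yields a derivation. *)
Lemma Tense_subst s A : Tense A -> Tense (subst s A).
Proof.
  induction 1; cbn [subst] in *;
    try (constructor; auto using int_axiom_subst; fail).
  (* Modus ponens remains, since its minor premise cannot be read off the goal. *)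
  eapply Tense_mp; eassumption.
Qed.

Lemma Tense_int_theory : int_theory Tense.
Proof. split; [exact Tense_int | exact Tense_mp]. Qed.

Lemma Int2GC_int_theory : int_theory Int2GC.
Proof.
  split; [| exact Int2GC_mp].
  intros A HA. now apply Int2GC_IPL, IPL_ax.
Qed.

(** The pairs cross the two time directions: future [F] goes with past [H], past [P] with future
    [G]. *)
Lemma Tense_adjoint_F_H : adjoint_in Tense F H.
Proof.
  exact (adjoint_of_unit_counit Tense F H Tense_int_theory
           Tense_RMF Tense_KH Tense_RH Tense_HF Tense_FH).
Qed.

Lemma Tense_adjoint_P_G : adjoint_in Tense P G.
Proof.
  exact (adjoint_of_unit_counit Tense P G Tense_int_theory
           Tense_RMP Tense_KG Tense_RG Tense_GP Tense_PG).
Qed.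

Lemma Int2GC_adjoint_F_H : adjoint_in Int2GC F H.
Proof. split; [exact Int2GC_FH | exact Int2GC_HF]. Qed.

Lemma Int2GC_adjoint_P_G : adjoint_in Int2GC P G.
Proof. split; [exact Int2GC_PG | exact Int2GC_GP]. Qed.

Lemma IPL_Tense A : IPL A -> Tense A.
Proof.
  induction 1; [now apply Tense_int | eapply Tense_mp; eassumption].
Qed.

Lemma Int2GC_Tense A : Int2GC A -> Tense A.
Proof.
  induction 1.
  - now apply IPL_Tense.
  - now apply Tense_subst.
  - eapply Tense_mp; eassumption.
  - now apply (proj1 Tense_adjoint_F_H).
  - now apply (proj2 Tense_adjoint_F_H).
  - now apply (proj1 Tense_adjoint_P_G).
  - now apply (proj2 Tense_adjoint_P_G).
Qed.

Lemma Tense_Int2GC A : Tense A -> Int2GC A.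
Proof.
  pose proof Int2GC_int_theory as T.
  pose proof Int2GC_adjoint_F_H as FH.
  pose proof Int2GC_adjoint_P_G as PG.
  intro HA. induction HA.
  - now apply (proj1 T).
  - now apply (adjoint_right_K Int2GC P G).
  - now apply (adjoint_right_K Int2GC F H).
  - now apply (adjoint_counit Int2GC F H).
  - now apply (adjoint_counit Int2GC P G).
  - now apply (adjoint_unit Int2GC F H).
  - now apply (adjoint_unit Int2GC P G).
  - eapply Int2GC_mp; eassumption.
  - now apply (adjoint_right_nec Int2GC F H).
  - now apply (adjoint_right_nec Int2GC P G).
  - now apply (adjoint_left_mono Int2GC F H).
  - now apply (adjoint_left_mono Int2GC P G).
Qed.

Theorem proposition5p4 : forall A : form, Tense A <-> Int2GC A.
Proof.
  intro A. split; [apply Tense_Int2GC | apply Int2GC_Tense].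
Qed.
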